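(* Let $F:\mathbb{R}^n\to\mathbb{R}^n$ be a piecewise linear function in abs-normal form $z=c+Zx+L|z|$, $F(x)=b+Jx+Y|z|$ which is simply switched, i.e. $L=0$, so that $F(x)=b+Jx+Y|c+Zx|$. If the kinks of $F$ satisfy the linear independence kink qualification (LIKQ), then $F$ is bijective if and only if it is coherently oriented.
   Context: Here $c\in\mathbb{R}^s$, $b\in\mathbb{R}^n$, $Z\in\mathbb{R}^{s\times n}$, $J\in\mathbb{R}^{n\times n}$, $Y\in\mathbb{R}^{n\times s}$, and $|\cdot|$ acts componentwise. For $x\in\mathbb{R}^n$ put $z(x)=c+Zx$. LIKQ: for every $x\in\mathbb{R}^n$, the rows $e_i^\top Z$ of $Z$ with indices $i$ such that $z_i(x)=c_i+e_i^\top Zx=0$ are linearly independent. For $\sigma\in\{-1,0,1\}^s$ let $P_\sigma=\{x\in\mathbb{R}^n:\mathrm{sign}(z(x))=\sigma\}$ (sign componentwise); $\sigma$ is called open if $P_\sigma$ is nonempty and open. On such $P_\sigma$, $F$ is affine with Jacobian $J_\sigma=J+Y\Sigma Z$, $\Sigma=\mathrm{diag}(\sigma)$. $F$ is coherently oriented if the determinants $\det J_\sigma$, for all open $\sigma$, are nonzero and have the same sign. *)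

(* Defs.v *)
From HB Require Import structures.
From mathcomp Require Import all_boot all_order all_algebra.
From mathcomp Require Import all_classical all_reals all_analysis.

Set Implicit Arguments.
Unset Strict Implicit.
Unset Printing Implicit Defensive.

Import Order.TTheory GRing.Theory Num.Theory.
Import numFieldNormedType.Exports.
Local Open Scope classical_set_scope.
Local Open Scope ring_scope.

Section AbsNormal.
Context {R : realType} {n s : nat}.
Implicit Types (c z sigma : 'cV[R]_s) (b x : 'cV[R]_n).
Implicit Types (Z : 'M[R]_(s, n)) (L : 'M[R]_s).
Implicit Types (J : 'M[R]_n) (Y : 'M[R]_(n, s)).

Definition abs_cv z : 'cV[R]_s := map_mx (fun t : R => `|t|) z.

Definition sign_cv z : 'cV[R]_s := map_mx (fun t : R => Num.sg t) z.

Definition strictly_lower L : Prop :=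
  forall i j : 'I_s, (i <= j)%N -> L i j = 0.

(* Strict lower triangularity of L makes the switching vector z determined by
   x through forward substitution, so the existential picks out the only z. *)
Definition abs_normal_form c b Z L J Y (F : 'cV[R]_n -> 'cV[R]_n) : Prop :=
  strictly_lower L /\
  forall x, exists z,
    z = c + Z *m x + L *m abs_cv z /\
    F x = b + J *m x + Y *m abs_cv z.

Definition simply_switched L : Prop := L = 0.

(* The switching vector of a simply switched function. *)
Definition switching c Z x : 'cV[R]_s := c + Z *m x.

(* [free] is taken on the family of active rows, indexed by the active i,
   so repeated or zero active rows violate the condition. *)
Definition LIKQ c Z : Prop :=
  forall x, free [seq row i Z | i <- enum 'I_s & switching c Z x i 0 == 0].

(* Elements of {-1, 0, 1}^s, as vectors with real entries. *)
Definition signature sigma : Prop :=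
  forall i : 'I_s, sigma i 0 \in [:: -1; 0; 1 : R].

Definition signature_cell c Z sigma : set 'cV[R]_n :=
  [set x | sign_cv (switching c Z x) = sigma].

Definition open_signature c Z sigma : Prop :=
  [/\ signature sigma, signature_cell c Z sigma !=set0
    & open (signature_cell c Z sigma)].

Definition cell_jacobian Z J Y sigma : 'M[R]_n :=
  J + Y *m diag_mx sigma^T *m Z.

Definition coherently_oriented c Z J Y : Prop :=
  (forall sigma, open_signature c Z sigma ->
     \det (cell_jacobian Z J Y sigma) != 0) /\
  (forall sigma tau, open_signature c Z sigma -> open_signature c Z tau ->
     Num.sg (\det (cell_jacobian Z J Y sigma)) =
     Num.sg (\det (cell_jacobian Z J Y tau))).

End AbsNormal.

(* Main.v *)
Require Import Defs.
From HB Require Import structures.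
From mathcomp Require Import all_boot all_order all_algebra.
From mathcomp Require Import all_classical all_reals all_analysis.
From mathcomp Require Import ring lra.

Set Implicit Arguments.
Unset Strict Implicit.
Unset Printing Implicit Defensive.

Import Order.TTheory GRing.Theory Num.Theory.
Import numFieldNormedType.Exports.
Local Open Scope ring_scope.

(** Write z(x) = c + Z x and M_D = J + Y diag(D) Z for a vector D of slopes in
    [-1, 1]^s.  Since |t| - |t'| = d (t - t') for some d in [-1, 1], every
    increment of F has the form F x - F x' = M_D (x - x'), where D_i is the
    common sign of z_i(x) and z_i(x') when these two agree.  Everything rests
    on the observation that det M_D is affine in each D_i separately, because
    D_i enters through a rank-one term.

    If F is injective, then det M_D is nonzero whenever, for some x, D_i is the
    sign of z_i(x) at every i with z_i(x) <> 0: by LIKQ the active components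
    of z can be prescribed near x, so that a kernel vector of M_D becomes, after
    scaling, the difference of two points with the same image
    ([injective_nonsingular]).  Moving x along a segment from one cell to
    another, the sign of this determinant is locally constant, hence constant
    ([nonsingular_same_sign]), which is coherent orientation.

    Conversely, assume coherent orientation.  A vector sigma of
    signs -1 and 1 such that sigma_i z_i(x) >= - rho for all i has a solution,
    for a small enough rho > 0, is an open signature:
    by a quantitative Farkas lemma ([farkas_bound]) the system with rho = 0 is
    then solvable, and LIKQ moves its solution into the open cell
    ([uniform_open_margin]).  The same rho serves all sigma and all x.  So on a
    ball of a fixed radius r, centred anywhere, all the slope vectors of F lie
    in a box whose vertices are open signatures, and since det M_D is affine in
    each coordinate it stays away from 0 on that box.  Replacing the absolute
    values that do not switch on the ball by linear terms gives a piecewise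
    linear map that agrees with F on the ball, expands distances by a uniform
    factor, and is surjective ([pl_map_surjective], by induction on the number
    of kinks).  Hence F is a local homeomorphism with uniform constants, and
    such a map is bijective ([uniform_local_homeo_bijective]): one reaches any
    y by steps of a fixed size, and a path from p to q with F p = F q, read as
    a fine chain of points, can be pushed along the rays towards F p until it
    collapses, with p and q staying fixed. *)

(** * Local homeomorphisms with uniform constants *)

Section UniformLocalHomeomorphism.
Variables (R : realType) (V : normedModType R) (F : V -> V) (r C K : R).
Hypotheses (r0 : 0 < r) (C0 : 0 < C) (K0 : 0 < K).
Hypothesis F_lipschitz : forall u v, `|F u - F v| <= K * `|u - v|.
Hypothesis F_expanding : forall x u v, `|u - x| <= r -> `|v - x| <= r ->
  `|u - v| <= C * `|F u - F v|.
Hypothesis F_local_onto : forall x w, C * `|w - F x| <= r ->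
  exists2 u, `|u - x| <= C * `|w - F x| & F u = w.

(** One step of path lifting: the image moves towards y by the fraction
    1 / (m + 1) of its distance to y, that is, by at most r / (3 C), and m + 1
    such steps lead to y. *)
Lemma step_towards y x (m : nat) :
    C * `|F x - y| <= m.+1%:R * (r / 3) ->
  exists2 u, `|u - x| <= Num.min (r / 3) (C * `|F x - y|) &
    F u = y + (m%:R / m.+1%:R) *: (F x - y).
Proof.
move=> Fxy; set w := y + _.
have m0 : 0 < m.+1%:R :> R by rewrite ltr0n.
have wE : w - F x = - (m.+1%:R^-1 *: (F x - y)).
  have ratioE : m%:R / m.+1%:R = 1 - m.+1%:R^-1 :> R.
    by rewrite -[m.+1]addn1 natrD; field; rewrite natr1 pnatr_eq0.
  by rewrite /w ratioE scalerBl scale1r addrA addrCA subrr addr0 addrAC subrr add0r.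
have w_le : C * `|w - F x| = (C * `|F x - y|) / m.+1%:R.
  by rewrite wE normrN normrZ gtr0_norm ?invr_gt0// mulrCA mulrC.
have le1 : C * `|w - F x| <= r / 3.
  by rewrite w_le ler_pdivrMr// [leRHS]mulrC.
have [|u ux Fu] := @F_local_onto x w; first by apply: le_trans le1 _; have := r0; lra.
exists u => //; rewrite le_min (le_trans ux)//= (le_trans ux)//.
by rewrite w_le ler_pdivrMr// ler_peMr ?mulr_ge0 ?ler1n// ltW.
Qed.

Lemma uniform_local_homeo_surjective y : exists x, F x = y.
Proof.
suff key m x : C * `|F x - y| <= m%:R * (r / 3) -> exists x', F x' = y.
  have r3 : 0 < r / 3 by have := r0; lra.
  have := archi_boundP (divr_ge0 (mulr_ge0 (ltW C0) (normr_ge0 (F 0 - y))) (ltW r3)).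
  set m := Num.bound _ => /ltW; rewrite ler_pdivrMr//.
  exact: key.
elim: m x => [x|m IH x Fxy].
  rewrite mul0r pmulr_rle0// normr_le0 subr_eq0 => /eqP <-.
  by exists x.
have [u _ Fu] := step_towards Fxy; apply: (IH u).
have m0 : 0 < m.+1%:R :> R by rewrite ltr0n.
rewrite Fu addrC addKr normrZ ger0_norm ?divr_ge0// mulrCA.
rewrite mulrAC ler_pdivrMr// -mulrA ler_wpM2l//.
by rewrite [leRHS]mulrC.
Qed.

(** Discrete form of lifting the homotopy that contracts the loop F (u i) to y
    along rays.  All points of the chain move by at most r / 3 in a step, and
    consecutive points are at most r / 3 apart, so a point, its successor and
    their new positions lie in one ball of radius r; there, closeness of the
    images gives back closeness of the new points, and the induction goes on.  After
    m steps all images equal y and the chain has collapsed to a point, while its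
    ends have not moved. *)
Lemma chain_contraction y m N (u : nat -> V) :
    (forall i, (i < N)%N -> `|u i - u i.+1| <= r / 3 /\
       C * `|F (u i) - F (u i.+1)| <= r / 3) ->
    (forall i, (i <= N)%N -> C * `|F (u i) - y| <= m%:R * (r / 3)) ->
    F (u 0%N) = y -> F (u N) = y ->
  u 0%N = u N.
Proof.
elim: m u => [|m IH] u close near_y F0 FN.
  have Fu i : (i <= N)%N -> F (u i) = y.
    move=> /near_y; rewrite mul0r pmulr_rle0// normr_le0 subr_eq0.
    by move/eqP.
  suff : forall i, (i <= N)%N -> u i = u 0%N by move=> /(_ N (leqnn N)).
  elim=> // i IHi iN; rewrite -(IHi (ltnW iN)).
  have [ui _] := close _ iN; apply/eqP.
  rewrite eq_sym -subr_eq0 -normr_le0.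
  have := @F_expanding (u i) (u i) (u i.+1).
  rewrite subrr normr0 (Fu i (ltnW iN)) (Fu i.+1 iN) subrr normr0 mulr0.
  apply; first exact: ltW.
  by rewrite distrC (le_trans ui)//; have := r0; lra.
have /choice[v vP] : forall i, exists v, (i <= N)%N ->
    `|v - u i| <= Num.min (r / 3) (C * `|F (u i) - y|) /\
    F v = y + (m%:R / m.+1%:R) *: (F (u i) - y).
  move=> i; case: (leqP i N) => [iN|]; last by exists 0.
  by have [v v1 v2] := step_towards (near_y _ iN); exists v.
have m0 : 0 < m.+1%:R :> R by rewrite ltr0n.
have c0 : 0 <= m%:R / m.+1%:R :> R by rewrite divr_ge0.
have c1 : m%:R / m.+1%:R <= 1 :> R by rewrite ler_pdivrMr// mul1r ler_nat.
have fixed i : (i <= N)%N -> F (u i) = y -> v i = u i.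
  move=> iN Fui; have [] := vP _ iN.
  rewrite Fui subrr normr0 mulr0 le_min => /andP[_].
  by rewrite normr_le0 subr_eq0 => /eqP.
have vu i : (i <= N)%N -> `|v i - u i| <= r / 3.
  by move=> /vP[]; rewrite le_min => /andP[].
have Fv i : (i <= N)%N -> F (v i) = y + (m%:R / m.+1%:R) *: (F (u i) - y).
  by move=> /vP[].
rewrite -(fixed 0%N)// -(fixed N)//.
apply: IH => [i iN|i iN||]; [| |by rewrite fixed|by rewrite fixed].
- have [uu Fuu] := close _ iN.
  have CF : C * `|F (v i) - F (v i.+1)| <= r / 3.
    rewrite Fv ?(ltnW iN)// Fv// opprD addrACA subrr add0r -scalerBr.
    rewrite opprB addrA subrK normrZ ger0_norm// mulrCA.
    by rewrite (le_trans _ Fuu)// ler_piMl// mulr_ge0// ltW.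
  split => //; apply: le_trans CF; apply: (F_expanding (x := u i)).
    by rewrite (le_trans (vu _ (ltnW iN)))//; have := r0; lra.
  rewrite -(subrK (u i.+1) (v i.+1)) -addrA (le_trans (ler_normD _ _))//.
  have := vu _ iN; rewrite distrC in uu; have := r0; lra.
- rewrite Fv// addrC addKr normrZ ger0_norm// mulrCA.
  rewrite mulrAC ler_pdivrMr// -mulrA ler_wpM2l//.
  by rewrite [leRHS]mulrC near_y.
Qed.

Lemma uniform_local_homeo_injective : injective F.
Proof.
move=> p q Fpq; pose D := `|p - q|.
have D0 : 0 <= D by exact: normr_ge0.
(* N is large enough for both the steps of the chain and, after applying F and
   multiplying by C, the steps of its image to be at most r / 3. *)
pose M := 1 + C * K; have M0 : 0 < M by rewrite addr_gt0// mulr_gt0.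
have r3 : 0 < r / 3 by have := r0; lra.
have := archi_boundP (divr_ge0 (mulr_ge0 (ltW M0) D0) (ltW r3)).
set N := Num.bound _; rewrite ltr_pdivrMr// => NP.
have N0 : 0 < N%:R :> R.
  by rewrite -(pmulr_lgt0 _ r3) (le_lt_trans _ NP)// mulr_ge0// ltW.
pose u i := p + (i%:R / N%:R) *: (q - p).
have u0 : u 0%N = p by rewrite /u mul0r scale0r addr0.
have uN : u N = q by rewrite /u divff ?gt_eqF// scale1r addrC subrK.
have uS i : `|u i - u i.+1| = D / N%:R.
  rewrite /u opprD addrACA subrr add0r -scalerBl -mulrBl -natr1 opprD addrA.
  rewrite subrr add0r normrZ mulN1r normrN gtr0_norm ?invr_gt0// mulrC.
  by rewrite distrC.
have DN : M * (D / N%:R) <= r / 3.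
  by rewrite mulrA ler_pdivrMr// [leRHS]mulrC ltW.
have DN0 : 0 <= D / N%:R by rewrite divr_ge0.
have CK0 : 0 <= C * K by rewrite mulr_ge0 ?ltW.
have CKDN0 : 0 <= C * K * (D / N%:R) by rewrite mulr_ge0.
have DN' : D / N%:R + C * K * (D / N%:R) <= r / 3.
  by move: DN; rewrite /M mulrDl mul1r.
have near_p i : (i <= N)%N -> `|u i - p| <= D.
  move=> iN; rewrite /u addrC addKr normrZ ger0_norm ?divr_ge0//.
  rewrite distrC ler_piMl//.
  by rewrite ler_pdivrMr// mul1r ler_nat.
have := archi_boundP (divr_ge0 (mulr_ge0 CK0 D0) (ltW r3)).
set m := Num.bound _ => /ltW; rewrite ler_pdivrMr// => mP.
rewrite -u0 -uN; apply: (@chain_contraction (F p) m).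
- move=> i _; split; first by rewrite uS; lra.
  apply: le_trans (_ : C * (K * (D / N%:R)) <= _); last by rewrite mulrA; lra.
  by rewrite ler_wpM2l ?(ltW C0)// -(uS i).
- move=> i iN; apply: le_trans mP; rewrite -mulrA ler_wpM2l ?(ltW C0)//.
  by rewrite (le_trans (F_lipschitz _ _))// ler_wpM2l ?(ltW K0)// near_p.
- by rewrite u0.
- by rewrite uN.
Qed.

Lemma uniform_local_homeo_bijective : bijective F.
Proof.
have [G GK] := choice uniform_local_homeo_surjective.
by exists G => // x; apply: uniform_local_homeo_injective; rewrite GK.
Qed.

End UniformLocalHomeomorphism.

(** * Determinants and norms *)

Lemma det_block_schur (R : comNzRingType) n (M : 'M[R]_n) (y : 'cV[R]_n)
    (z : 'rV[R]_n) :
  \det (block_mx 1%:M z (- y) M) = \det (M + y *m z).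
Proof.
have <- : \det (block_mx (1%:M : 'M[R]_1) 0 y 1%:M *m block_mx 1%:M z (- y) M) =
    \det (M + y *m z).
  rewrite mulmx_block !mul1mx !mul0mx !addr0 mulmx1 addrN addrC.
  by rewrite det_ublock det1 mul1r.
by rewrite det_mulmx det_lblock !det1 !mul1r.
Qed.

(** A determinant is affine along a rank-one direction: the update sits in the
    first row of a bordered matrix. *)
Lemma det_rank1_update (R : comNzRingType) n (M : 'M[R]_n) (y : 'cV[R]_n)
    (z : 'rV[R]_n) a :
  \det (M + a *: (y *m z)) = \det M + a * \det (block_mx 0 z (- y) M).
Proof.
rewrite scalemxAr -det_block_schur.
rewrite (@determinant_multilinear _ _ _ (block_mx 1%:M 0 (- y) M)
  (block_mx 0 z (- y) M) (lshift n ord0) 1 a).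
- by rewrite det_lblock det1 !mul1r.
- rewrite !block_mxEv !rowKu !row_id !scale_row_mx add_row_mx scale1r scaler0.
  by rewrite !scaler0 addr0 add0r.
- rewrite !block_mxEv !row'Ku; apply/matrixP => i j; rewrite !mxE.
  by case: splitP => [[]|k _].
- rewrite !block_mxEv !row'Ku; apply/matrixP => i j; rewrite !mxE.
  by case: splitP => [[]|k _].
Qed.

(** The form of the matrix determinant lemma needed to compare the solutions of
    two linear systems that differ by a rank-one term, without inverting M. *)
Lemma det_rank1_cramer (R : comNzRingType) n (M : 'M[R]_n) (y v : 'cV[R]_n)
    (z : 'rV[R]_n) a b :
    M *m v = (a * b) *: y ->
  \det (M + a *: (y *m z)) * b = \det M * (b + (z *m v) 0 0).
Proof.
move=> Mv; rewrite scalemxAl -det_block_schur.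
transitivity (\det (block_mx 1%:M z (- (a *: y)) M *m
    block_mx (b%:M : 'M[R]_1) 0 v 1%:M)).
  by rewrite det_mulmx det_lblock det1 mulr1 det_scalar1.
rewrite mulmx_block !mul1mx !mulmx0 !mulmx1 !add0r mul_mx_scalar Mv.
rewrite scalerN scalerA (mulrC b) addNr det_ublock mulrC; congr (_ * _).
by rewrite det_mx11 !mxE mulr1n.
Qed.

Lemma det_segment_sign (R : rcfType) n (A B : 'M[R]_n) :
    (forall t, 0 <= t <= 1 -> \det (A + t *: (B - A)) != 0) ->
  Num.sg (\det A) = Num.sg (\det B).
Proof.
move=> nz.
pose p := \det (map_mx polyC A + 'X *: map_mx polyC (B - A)).
have pE t : p.[t] = \det (A + t *: (B - A)).
  rewrite -horner_evalE -det_map_mx; congr (\det _).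
  by apply/matrixP => i j; rewrite !mxE /= horner_evalE !hornerE.
have p0 : p.[0] = \det A by rewrite pE scale0r addr0.
have p1 : p.[1] = \det B by rewrite pE scale1r addrC subrK.
have noroot q : q = p \/ q = - p -> q.[0] <= 0 <= q.[1] -> False.
  move=> qp /(poly_ivt ler01)[t t01]; rewrite rootE.
  have := nz t t01; rewrite -pE.
  by case: qp => ->; rewrite ?hornerN ?oppr_eq0 => /negPf ->.
have := noroot p (or_introl erefl); have := noroot (- p) (or_intror erefl).
rewrite !hornerN !p0 !p1 !oppr_le0 !oppr_ge0.
have := nz 0; rewrite lexx ler01 scale0r addr0 => /(_ isT).
have := nz 1; rewrite lexx ler01 scale1r (addrC A) subrK => /(_ isT).
by case: (ltgtP (\det A) 0); case: (ltgtP (\det B) 0) => //= B0 A0 _ _ F1 F2;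
  first [by rewrite !ltr0_sg|by rewrite !gtr0_sg|by case: (F1 isT)|by case: (F2 isT)].
Qed.

Lemma mx_entry_le_norm (R : realFieldType) m n (A : 'M[R]_(m, n)) i j :
  `|A i j| <= `|A|.
Proof.
rewrite [leRHS]mx_normrE.
exact: (le_bigmax _ (fun ij : 'I_m * 'I_n => `|A ij.1 ij.2|) (i, j)).
Qed.

Lemma mx_norm_le (R : realFieldType) m n (A : 'M[R]_(m, n)) b :
  0 <= b -> (forall i j, `|A i j| <= b) -> `|A| <= b.
Proof.
by move=> b0 Ab; rewrite [leLHS]mx_normrE; apply/bigmax_leP; split.
Qed.

Lemma mulmx_norm_le (R : realFieldType) m n p (A : 'M[R]_(m, n))
    (B : 'M[R]_(n, p)) b :
    0 <= b -> (forall i j, `|A i j| <= b) ->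
  `|A *m B| <= n%:R * b * `|B|.
Proof.
move=> b0 Ab; have nB : 0 <= `|B| by exact: normr_ge0.
apply: mx_norm_le => [|i j]; first by rewrite !mulr_ge0.
rewrite mxE (le_trans (ler_norm_sum _ _ _))//.
rewrite -mulrA mulr_natl -[X in _ *+ X]card_ord -sumr_const ler_sum// => k _.
by rewrite normrM ler_pM// mx_entry_le_norm.
Qed.

Lemma det_norm_le (R : realFieldType) n (A : 'M[R]_n) b :
  (forall i j, `|A i j| <= b) -> `|\det A| <= n`!%:R * b ^+ n.
Proof.
move=> Ab; rewrite (le_trans (ler_norm_sum _ _ _))//.
rewrite -(perm.card_Sn n) mulr_natl -sumr_const ler_sum// => s _.
rewrite normrM normrX normrN1 expr1n mul1r normr_prod.
rewrite -[n in leRHS]card_ord -prodr_const ler_prod// => i _.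
by rewrite normr_ge0 Ab.
Qed.

(** Lower bound for A v in terms of det A and of the size of A, by Cramer's
    rule; it is uniform over bounded matrices with determinant bounded away
    from 0. *)
Lemma norm_det_le (R : realFieldType) n (A : 'M[R]_n) b (v : 'cV[R]_n) :
    0 <= b -> (forall i j, `|A i j| <= b) ->
  `|\det A| * `|v| <=
    n%:R * (n.-1`!%:R * b ^+ n.-1) * `|A *m v|.
Proof.
move=> b0 Ab.
have -> : `|\det A| * `|v| = `|\adj A *m (A *m v)|.
  by rewrite mulmxA mul_adj_mx mul_scalar_mx normrZ.
apply: mulmx_norm_le => [|i j]; first by rewrite mulr_ge0 ?exprn_ge0.
rewrite mxE normrM normrX normrN1 expr1n mul1r.
by apply: det_norm_le => k l; rewrite !mxE.
Qed.

(** * Linear systems and inequalities *)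

Lemma free_rows_solve (K : fieldType) s n (Z : 'M[K]_(s, n)) (P : pred 'I_s)
    (a : 'I_s -> K) :
    free [seq row i Z | i <- enum 'I_s & P i] ->
  exists w : 'cV[K]_n, forall i, P i -> (Z *m w) i 0 = a i.
Proof.
set t := [seq i <- enum 'I_s | P i] => Zfree.
pose X := in_tuple [seq row i Z | i <- t].
pose phi v : K := \sum_(k < size [seq row i Z | i <- t]) nth 0 (map a t) k * coord X k v.
have phiE v : phi v = \sum_j v 0 j * phi (delta_mx 0 j).
  rewrite /phi [in LHS](row_sum_delta v).
  under eq_bigr do rewrite linear_sum mulr_sumr.
  rewrite exchange_big; apply: eq_bigr => j _; rewrite mulr_sumr.
  by apply: eq_bigr => k _; rewrite linearZ/= mulrCA.
(* phi is the linear form with the prescribed values on the free family, and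
   the solution is the column that represents it. *)
exists (\col_j phi (delta_mx 0 j)) => i Pi.
rewrite mxE.
transitivity (phi (row i Z)).
  by rewrite phiE; apply: eq_bigr => j _; rewrite !mxE.
have it : i \in t by rewrite mem_filter Pi mem_enum.
have kP : (index i t < size [seq row i Z | i <- t])%N by rewrite size_map index_mem.
rewrite /phi (bigD1 (Ordinal kP))//= big1 ?addr0 => [|k ki].
  rewrite -[row i Z](_ : X`_(Ordinal kP) = _); last first.
    by rewrite /= (nth_map i) ?nth_index// index_mem.
  by rewrite coord_free// eqxx mulr1 (nth_map i) ?nth_index// index_mem.
rewrite -[row i Z](_ : X`_(Ordinal kP) = _); last first.
  by rewrite /= (nth_map i) ?nth_index// index_mem.
by rewrite coord_free// eq_sym (negbTE ki) mulr0.
Qed.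

(** Quantitative Farkas lemma.  The proof is Bartl's induction on the number of
    forms: if the first form b is needed, some y satisfies the others but not
    g y >= 0, hence b y < 0, and sliding x along y to the hyperplane b = 0
    removes b from the system.  The constant C plays the role of the sum of
    the Farkas multipliers. *)
Lemma farkas_bound (R : realFieldType) n (s : seq 'rV[R]_n) (g : 'rV[R]_n) :
    (forall x : 'cV[R]_n, (forall a, a \in s -> 0 <= (a *m x) 0 0) ->
       0 <= (g *m x) 0 0) ->
  exists2 C, 0 <= C & forall (x : 'cV[R]_n) rho, 0 <= rho ->
    (forall a, a \in s -> - rho <= (a *m x) 0 0) -> - (C * rho) <= (g *m x) 0 0.
Proof.
have [k sz] := ubnP (size s); elim: k s g sz => // k IH [|b s] g /= sz Hg.
  exists 0 => // x rho _ _; rewrite mul0r oppr0; exact: Hg.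
have [Hs|] := pselect (forall x : 'cV[R]_n, (forall a, a \in s -> 0 <= (a *m x) 0 0) ->
   0 <= (g *m x) 0 0).
  have [C C0 CP] := IH s g sz Hs; exists C => // x rho rho0 Hx.
  by apply: CP => // a sa; apply: Hx; rewrite inE sa orbT.
move=> /existsNP[y /not_implyP[ys /negP]]; rewrite -ltNge => gy.
have by0 : (b *m y) 0 0 < 0.
  rewrite ltNge; apply/negP => by0; move: gy; rewrite ltNge => /negP; apply.
  by apply: Hg => a; rewrite inE => /predU1P[->//|/ys].
pose al := - (b *m y) 0 0; have al0 : 0 < al by rewrite oppr_gt0.
(* The form x |-> a (al x + (b x) y), that is, a after projecting to the
   kernel of b along y and scaling by al. *)
pose tilt a := al *: a + (a *m y) 0 0 *: b.
have tiltE a x : (tilt a *m x) 0 0 = al * (a *m x) 0 0 + (b *m x) 0 0 * (a *m y) 0 0.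
  by rewrite /tilt mulmxDl -!scalemxAl !mxE [in RHS](mulrC (\sum_j _ * x j 0)).
have [||C C0 CP] := IH (map tilt s) (tilt g).
- by rewrite size_map.
- move=> x Hx.
  pose x' := al *: x + (b *m x) 0 0 *: y.
  have x'E a : (a *m x') 0 0 = (tilt a *m x) 0 0.
    by rewrite tiltE /x' mulmxDr -!scalemxAr !mxE.
  rewrite -x'E; apply: Hg => a; rewrite inE => /predU1P[->|sa].
    by rewrite x'E tiltE /al mulNr mulrC addNr.
  by rewrite x'E Hx// map_f.
pose S := \sum_(a <- s) (a *m y) 0 0.
have leS a : a \in s -> 0 <= (a *m y) 0 0 <= S.
  move=> sa; rewrite ys//= /S (big_rem a)//= lerDl.
  rewrite big_seq sumr_ge0// => c /mem_rem; exact: ys.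
have S0 : 0 <= S by rewrite /S big_seq sumr_ge0// => a /ys.
exists ((C * (al + S) - (g *m y) 0 0) / al).
  by rewrite divr_ge0 ?ltW// subr_gt0 (lt_le_trans gy)// mulr_ge0// addr_ge0// ltW.
move=> x rho rho0 Hx.
have bx : - rho <= (b *m x) 0 0 by apply: Hx; rewrite inE eqxx.
have := CP x (rho * (al + S)).
rewrite tiltE => H.
have {}H : - (C * (rho * (al + S))) <= al * (g *m x) 0 0 + (b *m x) 0 0 * (g *m y) 0 0.
  apply: H => [|_ /mapP[a sa ->]]; first by rewrite mulr_ge0// addr_ge0// ltW.
  have ax : - rho <= (a *m x) 0 0 by apply: Hx; rewrite inE sa orbT.
  have /andP[ay0 ayS] := leS a sa.
  rewrite tiltE; nra.
rewrite -(ler_pM2l al0); apply: le_trans (_ : - (C * (rho * (al + S))) + rho * (g *m y) 0 0 <= _).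
  rewrite le_eqVlt; apply/orP; left; apply/eqP; field; exact: lt0r_neq0.
nra.
Qed.

(** * Piecewise linear maps with independent kinks *)

Lemma uniform_radius (R : realType) (I : finType) (P : I -> R -> Prop) :
    (forall i, exists2 e, 0 < e & forall e', 0 < e' <= e -> P i e') ->
  exists2 e, 0 < e & forall i, P i e.
Proof.
move=> /fin_all_exists2[f f0 fP].
have e0 : 0 < \big[Num.min/1]_i f i by apply: lt_bigmin.
by exists (\big[Num.min/1]_i f i) => // i; apply: fP; rewrite e0 bigmin_le.
Qed.

Section SwitchedMaps.
Variables (R : realType) (n s : nat).
Variables (c : 'cV[R]_s) (b : 'cV[R]_n) (Z : 'M[R]_(s, n)).
Variables (J : 'M[R]_n) (Y : 'M[R]_(n, s)).
Implicit Types (x u v w : 'cV[R]_n) (l h D : 'cV[R]_s).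

Local Notation z x := (switching c Z x).
Local Notation jac := (cell_jacobian Z J Y).

Definition in_box l h D := forall i, l i 0 <= D i 0 <= h i 0.

Definition set_coord D (k : 'I_s) e : 'cV[R]_s :=
  \col_i if i == k then e else D i 0.

Lemma set_coordE D k e i : set_coord D k e i 0 = if i == k then e else D i 0.
Proof. by rewrite mxE. Qed.

Lemma cell_jacobianE D i j :
  jac D i j = J i j + \sum_k Y i k * D k 0 * Z k j.
Proof.
rewrite !mxE; congr (_ + _); apply: eq_bigr => k _.
by rewrite mul_mx_diag !mxE.
Qed.

Lemma cell_jacobian_mulmx D v :
  jac D *m v = J *m v + Y *m (\col_i (D i 0 * (Z *m v) i 0)).
Proof.
rewrite /cell_jacobian mulmxDl -!mulmxA; congr (_ + Y *m _).
by rewrite mul_diag_mx; apply/colP => i; rewrite !mxE.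
Qed.

Lemma cell_jacobian_affine D D' t :
  jac (D + t *: (D' - D)) = jac D + t *: (jac D' - jac D).
Proof.
apply/matrixP => i j; rewrite [RHS]mxE [X in _ = _ + X]mxE.
rewrite [X in _ = _ + _ * X]mxE [X in _ = _ + _ * (_ + X)]mxE !cell_jacobianE opprD addrACA subrr add0r.
rewrite -addrA -sumrB mulr_sumr -big_split; congr (_ + _).
by apply: eq_bigr => k _ /=; rewrite !mxE; ring.
Qed.

Lemma cell_jacobian_set D k e :
  jac (set_coord D k e) = jac D + (e - D k 0) *: (col k Y *m row k Z).
Proof.
apply/matrixP => i j; rewrite cell_jacobianE mxE cell_jacobianE -addrA.
congr (_ + _); rewrite (bigD1 k)//= [in RHS](bigD1 k)//= set_coordE eqxx.
rewrite !mxE big_ord1 !mxE addrAC; congr (_ + _); first by ring.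
by apply: eq_bigr => m /negPf mk; rewrite set_coordE mk.
Qed.

Lemma switchingB x x' i : z x i 0 - z x' i 0 = (Z *m (x - x')) i 0.
Proof.
rewrite mulmxBr /switching; move: (Z *m x) (Z *m x') => u v.
by rewrite !mxE; ring.
Qed.

Lemma switchingD x t v i : z (x + t *: v) i 0 = z x i 0 + t * (Z *m v) i 0.
Proof.
by rewrite /switching mulmxDr -scalemxAr addrA mxE [X in _ + X]mxE.
Qed.

(** The increment of F seen through the secant slopes D of its kinks. *)
Lemma secant_jacobian x x' (p p' D : 'cV[R]_s) :
    (forall i, p i 0 - p' i 0 = D i 0 * (z x i 0 - z x' i 0)) ->
  (b + J *m x + Y *m p) - (b + J *m x' + Y *m p') = jac D *m (x - x').
Proof.
move=> pp'; rewrite cell_jacobian_mulmx.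
have -> : \col_i (D i 0 * (Z *m (x - x')) i 0) = p - p'.
  by apply/colP => i; rewrite mxE -switchingB -pp' !mxE.
rewrite !mulmxBr opprD addrACA; congr (_ + _).
by rewrite opprD addrACA subrr add0r.
Qed.

Lemma switching_lipschitz x x' i :
  `|z x i 0 - z x' i 0| <= n%:R * `|Z| * `|x - x'|.
Proof.
rewrite switchingB (le_trans (mx_entry_le_norm _ _ _))//.
by apply: mulmx_norm_le => // k j; exact: mx_entry_le_norm.
Qed.

Lemma sign_stable x : exists2 e, 0 < e & forall x', `|x' - x| <= e ->
  forall i, z x i 0 != 0 -> Num.sg (z x' i 0) = Num.sg (z x i 0).
Proof.
have [|e e0 eP] := @uniform_radius R 'I_s (fun i e => forall x',
  `|x' - x| <= e -> z x i 0 != 0 -> Num.sg (z x' i 0) = Num.sg (z x i 0)).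
  move=> i; have [->|zi] := eqVneq (z x i 0) 0; first by exists 1.
  have K0 : 0 < n%:R * `|Z| + 1 :> R by rewrite ltr_wpDl// mulr_ge0.
  exists (`|z x i 0| / (n%:R * `|Z| + 1) / 2).
    by rewrite !divr_gt0// normr_gt0.
  move=> e /andP[e0 ele] x' x'x _.
  have : `|z x' i 0 - z x i 0| < `|z x i 0|.
    rewrite (le_lt_trans (switching_lipschitz _ _ _))//.
    have : `|x' - x| < `|z x i 0| / (n%:R * `|Z| + 1).
      rewrite (le_lt_trans x'x)// (le_lt_trans ele)// ltr_pdivrMr// ltr_pMr ?ltr1n//.
      by rewrite divr_gt0// normr_gt0.
    rewrite ltr_pdivlMr//; apply: le_lt_trans.
    by rewrite mulrDr mulr1 [leLHS]mulrC lerDl.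
  case: (ltrgt0P (z x i 0)) zi => // zi _; rewrite ltr_distl => /andP[].
    by rewrite subrr => zx' _; rewrite !gtr0_sg.
  by rewrite addrN => _ zx'; rewrite !ltr0_sg.
by exists e => // x' x'x i; apply: eP.
Qed.

(** Each |t| is replaced by the function with slope l on t < 0 and slope h on
    t >= 0.  This family contains the original map (slopes -1 and 1) and is
    closed under replacing a kink by a linear term (l = h), which is what the
    induction on the number of kinks requires. *)
Definition pl_cv l h (y : 'cV[R]_s) : 'cV[R]_s :=
  \col_i ((if 0 <= y i 0 then h i 0 else l i 0) * y i 0).

Lemma pl_cvE l h y i :
  pl_cv l h y i 0 = (if 0 <= y i 0 then h i 0 else l i 0) * y i 0.
Proof. by rewrite mxE. Qed.

Definition pl_map l h x := b + J *m x + Y *m pl_cv l h (z x).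

Lemma slope_secant (l h t t' : R) : l <= h ->
  exists2 d, l <= d <= h & (if 0 <= t then h else l) * t -
    (if 0 <= t' then h else l) * t' = d * (t - t').
Proof.
move=> lh; have [->|tt'] := eqVneq t t'.
  by exists l; rewrite ?lexx// !subrr mulr0.
set q := _ - _; exists (q / (t - t')); last by rewrite divfK// subr_eq0.
have [t't|tt'2|] := ltgtP t' t; last by move/eqP: tt' => + tt'; rewrite tt'.
  have ?: 0 < t - t' by rewrite subr_gt0.
  by rewrite ler_pdivlMr// ler_pdivrMr// /q; apply/andP; split;
    do 2 (case: ifPn => ?); nra.
have ?: t - t' < 0 by rewrite subr_lt0.
by rewrite ler_ndivlMr// ler_ndivrMr// /q; apply/andP; split;
    do 2 (case: ifPn => ?); nra.
Qed.

Lemma pl_map_secant l h x x' : (forall i, l i 0 <= h i 0) ->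
  exists2 D, in_box l h D & pl_map l h x - pl_map l h x' = jac D *m (x - x').
Proof.
move=> lh.
have /fin_all_exists2[f f1 f2] := fun i =>
  slope_secant (z x i 0) (z x' i 0) (lh i).
exists (\col_i f i); first by move=> i; rewrite mxE.
by apply: secant_jacobian => i; rewrite !pl_cvE f2 [X in _ = X * _]mxE.
Qed.

Lemma pl_map_coordB l h l' h' k t x :
    (forall i, pl_cv l h (z x) i 0 - pl_cv l' h' (z x) i 0 = t *+ (i == k)) ->
  pl_map l h x - pl_map l' h' x = t *: col k Y.
Proof.
move=> H; rewrite /pl_map opprD addrACA (addrN (b + _)) add0r -mulmxBr colE scalemxAr.
congr (_ *m _); apply/colP => i; rewrite mxE [in X in _ + X]mxE H !mxE eqxx andbT.
by case: eqP; rewrite ?mulr1 ?mulr0.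
Qed.

(** Induction on the number of genuine kinks (l_k < h_k).  Make the k-th kink
    linear, with slope l_k or with slope h_k; the induction hypothesis gives
    solutions u1 and u2.  If z_k(u2) >= 0, then u2 solves the original equation,
    and if z_k(u1) < 0, then u1 does.  One of the two happens because z_k(u1)
    and z_k(u2) have the same sign: their quotient is a quotient of two
    determinants det M_D with D in the box, by [det_rank1_cramer]. *)
Lemma pl_map_surjective eps l h w : (forall i, l i 0 <= h i 0) ->
    (forall D, in_box l h D -> 0 < eps * \det (jac D)) ->
  exists u, pl_map l h u = w.
Proof.
have [m] := ubnP #|[pred i | l i 0 != h i 0]|.
elim: m l h => // m IH l h; rewrite ltnS => lhm lh pos.
have [/existsP[k lk]|] := boolP [exists i, l i 0 != h i 0]; last first.
  rewrite negb_exists => /forallP/(_ _)/negPn/eqP lhE.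
  have detl : jac l \in unitmx.
    rewrite unitmxE unitfE.
    have /pos : in_box l h l by move=> i; rewrite lexx lh.
    by apply: contraTneq => ->; rewrite mulr0 ltxx.
  exists (invmx (jac l) *m (w - pl_map l h 0)).
  have [D Dbox] := pl_map_secant (invmx (jac l) *m (w - pl_map l h 0)) 0 lh.
  have -> : D = l.
    by apply/colP => i; apply/eqP; rewrite eq_le andbC {2}lhE Dbox.
  by rewrite subr0 mulKVmx// => /addIr.
have lthk : l k 0 < h k 0 by rewrite lt_neqAle lk lh.
have fewer l' h' : (forall i, i != k -> l' i 0 = l i 0 /\ h' i 0 = h i 0) ->
    l' k 0 = h' k 0 -> (#|[pred i | (l' i 0 != h' i 0)%R]| < m)%N.
  move=> E Ek; apply: leq_trans lhm; apply: proper_card; apply/properP; split.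
    apply/fintype.subsetP => i; rewrite !inE; have [->|ik] := eqVneq i k.
      by rewrite Ek eqxx.
    by have [-> ->] := E i ik.
  by exists k; rewrite inE ?lk// Ek eqxx.
have [||D Dbox|u1 u1w] := IH l (set_coord h k (l k 0)).
- apply: fewer => [i /negPf ik|]; by rewrite set_coordE ?ik ?eqxx.
- by move=> i; rewrite set_coordE; case: eqP => [->|].
- apply: pos => i; have := Dbox i; rewrite set_coordE; case: eqP => // ->.
  by move=> /andP[-> /=]; move/le_trans; apply; exact: ltW.
have [||D Dbox|u2 u2w] := IH (set_coord l k (h k 0)) h.
- apply: fewer => [i /negPf ik|]; by rewrite set_coordE ?ik ?eqxx.
- by move=> i; rewrite set_coordE; case: eqP => [->|].
- apply: pos => i; have := Dbox i; rewrite set_coordE; case: eqP => // ->.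
  by move=> /andP[+ ->]; rewrite andbT; apply: le_trans; exact: ltW.
have [z2|z2] := leP 0 (z u2 k 0).
  exists u2; rewrite -u2w; congr (_ + _ *m _); apply/colP => i.
  by rewrite !pl_cvE set_coordE; case: eqP => [->|//]; rewrite z2.
exists u1; rewrite -u1w; congr (_ + _ *m _); apply/colP => i.
rewrite !pl_cvE set_coordE; case: eqP => [->|//]; rewrite leNgt.
suff -> : z u1 k 0 < 0 by []; clear i.
have [|D Dbox] := @pl_map_secant l (set_coord h k (l k 0)) u1 u2.
  by move=> i; rewrite set_coordE; case: eqP => [->|].
have Dk : D k 0 = l k 0.
  by apply/eqP; rewrite eq_le andbC; have := Dbox k; rewrite set_coordE eqxx.
rewrite u1w -u2w.
rewrite (@pl_map_coordB _ _ _ _ k ((h k 0 - l k 0) * z u2 k 0)); last first.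
  move=> i; rewrite !pl_cvE !set_coordE; case: eqP => [->|_]; last by rewrite subrr.
  by rewrite leNgt z2 /= mulrBl.
move=> /esym/(det_rank1_cramer (row k Z)).
have -> : (row k Z *m (u1 - u2)) 0 0 = z u1 k 0 - z u2 k 0.
  by rewrite switchingB -row_mul mxE.
rewrite [z u2 k 0 + _]addrC subrK -{1}Dk -cell_jacobian_set.
have pos1 : 0 < eps * \det (jac D).
  apply: pos => i; have := Dbox i; rewrite set_coordE; case: eqP => // ->.
  by move=> /andP[-> /=]; move/le_trans; apply; exact: ltW.
have pos2 : 0 < eps * \det (jac (set_coord D k (h k 0))).
  apply: pos => i; have := Dbox i; rewrite !set_coordE; case: eqP => // ->.
  by rewrite lh lexx.
move=> /(congr1 ( *%R eps)); rewrite !mulrA => E.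
by rewrite -(pmulr_rlt0 _ pos1) -E pmulr_rlt0.
Qed.

Definition switched_map x := b + J *m x + Y *m abs_cv (z x).

Lemma switched_mapE x : switched_map x = pl_map (const_mx (-1)) (const_mx 1) x.
Proof.
rewrite /switched_map /pl_map; congr (_ + _ *m _); apply/colP => i.
rewrite pl_cvE [LHS]mxE [const_mx 1 i 0]mxE [const_mx (-1) i 0]mxE.
by have [zi|zi] := leP 0 (z x i 0); rewrite ?(ger0_norm zi) ?(ltr0_norm zi); lra.
Qed.

End SwitchedMaps.

(** * Injective maps are coherently oriented *)

Section CoherentOrientation.
Variables (R : realType) (n s : nat).
Variables (c : 'cV[R]_s) (b : 'cV[R]_n) (Z : 'M[R]_(s, n)).
Variables (J : 'M[R]_n) (Y : 'M[R]_(n, s)).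
Implicit Types (x u v w : 'cV[R]_n) (l h D sigma : 'cV[R]_s).

Local Notation z x := (switching c Z x).
Local Notation jac := (cell_jacobian Z J Y).
Local Notation pl := (pl_map c b Z J Y).
Local Notation F := (switched_map c b Z J Y).

(** The slopes D for which M_D is a secant matrix of F between points
    arbitrarily close to x. *)
Definition kink_box x D :=
  forall i, `|D i 0| <= 1 /\ (z x i 0 != 0 -> D i 0 = Num.sg (z x i 0)).

Lemma LIKQ_solve x (a : 'I_s -> R) : LIKQ c Z ->
  exists w, forall i, z x i 0 = 0 -> (Z *m w) i 0 = a i.
Proof.
move=> /(_ x)/(free_rows_solve a)[w wP].
by exists w => i zi; apply: wP; rewrite zi.
Qed.

(** Any slope d in [-1, 1] is the secant slope of |.| between two points with
    prescribed difference h. *)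
Lemma kink_split (h d : R) : `|d| <= 1 ->
  `|(h + d * `|h|) / 2| - `|(h + d * `|h|) / 2 - h| = d * h.
Proof.
rewrite ler_norml => /andP[d1 d2]; have [h0|h0] := leP 0 h.
  by rewrite (ger0_norm h0) ger0_norm ?ler0_norm; [field|nra|nra].
by rewrite (ltr0_norm h0) ler0_norm ?ger0_norm; [field|nra|nra].
Qed.

(** If M_D u = 0, then x + t w and x + t (w - u) have the same image for small
    t > 0, provided that w makes D the secant slopes of the active kinks, as
    in [kink_split]; LIKQ provides such a w. *)
Lemma injective_nonsingular : LIKQ c Z ->
    injective F ->
  forall x D, kink_box x D -> \det (jac D) != 0.
Proof.
move=> likq Finj x D Dx; apply/eqP => /eqP; rewrite -det_tr => /det0P[v v0 vD].
pose u := v^T; pose hu i := (Z *m u) i 0.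
have u0 : u != 0 by rewrite -(inj_eq trmx_inj) trmxK trmx0.
have Du : jac D *m u = 0 by rewrite -[RHS]trmx0 -vD trmx_mul trmxK.
have [w wP] := LIKQ_solve x (fun i => (hu i + D i 0 * `|hu i|) / 2) likq.
have [e e0 eP] := sign_stable c Z x.
pose N := `|w| + `|w - u| + 1; have N0 : 0 < N.
  by rewrite ltr_wpDl// addr_ge0.
pose t := e / N; have t0 : 0 < t by rewrite divr_gt0.
have tle v' : `|v'| <= N -> `|x + t *: v' - x| <= e.
  move=> v'N; rewrite addrC addKr normrZ gtr0_norm// mulrAC ler_pdivrMr//.
  by rewrite ler_pM2l.
have le1 : `|w| <= N by rewrite /N -addrA lerDl addr_ge0.
have le2 : `|w - u| <= N by rewrite /N addrAC -[leLHS]add0r lerD// addr_ge0.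
clearbody t; have /Finj/eqP : F (x + t *: w) = F (x + t *: (w - u)).
  apply/eqP; rewrite -subr_eq0 /switched_map (@secant_jacobian _ _ _ c b Z J Y _ _ _ _ D).
    by rewrite opprD addrACA subrr add0r -scalerBr subKr -scalemxAr Du scaler0.
  move=> i; have [Di1 Di] := Dx i.
  rewrite [abs_cv _ i 0]mxE [abs_cv (z (x + t *: (w - u))) i 0]mxE.
  have [zi|zi] := eqVneq (z x i 0) 0.
    have Zwu : (Z *m (w - u)) i 0 = (hu i + D i 0 * `|hu i|) / 2 - hu i.
      by rewrite -(wP i zi) /hu mulmxBr mxE [X in _ + X]mxE.
    rewrite !switchingD zi !add0r Zwu wP//.
    have := kink_split (hu i) Di1; move: (_ / 2) => a split_a.
    rewrite (normrM t a) (normrM t (a - hu i)) (gtr0_norm t0) -mulrBr.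
    by rewrite split_a; ring.
  rewrite (Di zi) mulrBr -{1}(eP _ (tle _ le1) i zi) -(eP _ (tle _ le2) i zi).
  by rewrite !normrEsg.
rewrite -subr_eq0 opprD addrACA subrr add0r -scalerBr subKr scaler_eq0.
by rewrite (negPf u0) orbF gt_eqF.
Qed.

Lemma kink_box_sign x x' e : `|x' - x| <= e ->
    (forall x', `|x' - x| <= e ->
       forall i, z x i 0 != 0 -> Num.sg (z x' i 0) = Num.sg (z x i 0)) ->
  kink_box x (sign_cv (z x')).
Proof.
move=> x'x eP i; rewrite [sign_cv _ i 0]mxE; split; last exact: eP.
by rewrite normr_sg; case: eqP.
Qed.

(** Near a point x of the segment from p to q all sign vectors belong to
    [kink_box x], which is convex and on which the determinant has no zero.  So
    the sign of the determinant is a locally constant function on the segment;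
    as a continuous function with values in {-1, 1} it is constant. *)
Lemma nonsingular_same_sign :
    (forall x D, kink_box x D -> \det (jac D) != 0) ->
  forall p q, Num.sg (\det (jac (sign_cv (z p)))) =
              Num.sg (\det (jac (sign_cv (z q)))).
Proof.
move=> ns p q.
pose f t := Num.sg (\det (jac (sign_cv (z (p + t *: (q - p)))))).
have box_sign x D D' : kink_box x D -> kink_box x D' ->
    Num.sg (\det (jac D)) = Num.sg (\det (jac D')).
  move=> Dx D'x; apply: det_segment_sign => t t01.
  rewrite -cell_jacobian_affine; apply: (ns x) => i.
  have [Di Dz] := Dx i; have [D'i D'z] := D'x i.
  move: Di D'i; rewrite !ler_norml => /andP[? ?] /andP[? ?].
  case/andP: t01 => t0 t1.
  have -> : (D + t *: (D' - D)) i 0 = D i 0 + t * (D' i 0 - D i 0).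
    by rewrite !mxE.
  split.
    by apply/andP; split; nra.
  by move=> zi; rewrite Dz// D'z// subrr mulr0 addr0.
have self x : kink_box x (sign_cv (z x)).
  move=> i; rewrite [sign_cv _ i 0]mxE; split => //.
  by rewrite normr_sg; case: eqP.
have f_cont : continuous f.
  move=> t; apply: (near_cst_continuous (f t)).
  pose x := p + t *: (q - p).
  have [e e0 eP] := sign_stable c Z x.
  have N0 : 0 < `|q - p| + 1 by rewrite ltr_wpDl.
  apply/nbhs_ballP; exists (e / (`|q - p| + 1)); first exact: divr_gt0.
  move=> t'.
  rewrite -ball_normE /= => /ltW t't; rewrite /f.
  apply: (box_sign x); last exact: self.
  apply: (kink_box_sign (e := e)) => //.
  rewrite /x opprD addrACA subrr add0r -scalerBl normrZ distrC.
  move: t't.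
  rewrite ler_pdivlMr//; apply: le_trans.
  by rewrite ler_wpM2l// lerDl.
have f0 t : f t != 0.
  by rewrite /f sgr_eq0; apply: (ns _ _ (self _)).
have -> : Num.sg (\det (jac (sign_cv (z p)))) = f 0.
  by rewrite /f scale0r addr0.
have -> : Num.sg (\det (jac (sign_cv (z q)))) = f 1.
  by rewrite /f scale1r addrC subrK.
have fpm t : f t = 1 \/ f t = -1.
  have := f0 t; rewrite /f; case: sgrP; rewrite ?eqxx// => _ _; by [left|right].
have noz : ~ (Num.min (f 0) (f 1) <= 0 <= Num.max (f 0) (f 1)).
  move=> /(IVT ler01 (continuous_subspaceT f_cont))[t _ /eqP].
  exact/negP.
move: noz; case: (fpm 0) => ->; case: (fpm 1) => -> // [];
  by rewrite ge_min le_max lerN10 ler01 ?orbT.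
Qed.

Lemma injective_oriented : LIKQ c Z ->
    injective F ->
  coherently_oriented c Z J Y.
Proof.
move=> likq Finj; have ns := injective_nonsingular likq Finj.
split=> [sigma [_ [x <-] _]|sigma tau [_ [x <-] _] [_ [y <-] _]].
  apply: (ns x) => i; rewrite [sign_cv _ i 0]mxE; split => //.
  by rewrite normr_sg; case: eqP.
exact: nonsingular_same_sign.
Qed.

(** * Open signatures *)

Definition full_signature sigma : Prop :=
  forall i, (sigma i 0 == 1) || (sigma i 0 == -1).

Lemma open_signature_orthant x sigma :
    full_signature sigma ->
    (forall i, 0 < sigma i 0 * z x i 0) ->
  open_signature c Z sigma.
Proof.
move=> sigma1 pos.
have sg_sigma (y : R) i : (Num.sg y == sigma i 0) = (0 < sigma i 0 * y).
  have /orP[] := sigma1 i => /eqP ->; first by rewrite mul1r sgr_cp0.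
  by rewrite mulN1r oppr_gt0 sgr_cp0.
have cellP y : signature_cell c Z sigma y <-> forall i, 0 < sigma i 0 * z y i 0.
  split=> [/colP yE i|yE]; first by rewrite -sg_sigma -yE [sign_cv _ i 0]mxE.
  by apply/colP => i; rewrite [sign_cv _ i 0]mxE; apply/eqP; rewrite sg_sigma.
split.
- by move=> i; rewrite !inE orbC; have /orP[] := sigma1 i => ->; rewrite ?orbT.
- by exists x; apply/cellP.
- rewrite openE => y /cellP yE; rewrite /interior.
  have [e e0 eP] := sign_stable c Z y.
  apply/nbhs_ballP; exists e => // y'.
  rewrite -ball_normE /= distrC => /ltW y'y; apply/cellP => i.
  rewrite -sg_sigma (eP _ y'y) ?sg_sigma//.
  by apply: contraTneq (yE i) => ->; rewrite mulr0 ltxx.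
Qed.

(** A point where sigma_i z_i >= 0 can be moved into the open cell: by LIKQ
    there is a direction in which every active sigma_i z_i grows. *)
Lemma open_signature_closure x sigma : LIKQ c Z ->
    full_signature sigma ->
    (forall i, 0 <= sigma i 0 * z x i 0) ->
  open_signature c Z sigma.
Proof.
move=> likq sigma1 nonneg.
have [w wP] := LIKQ_solve x (fun i => sigma i 0) likq.
have [e e0 eP] := sign_stable c Z x.
have N0 : 0 < `|w| + 1 by rewrite ltr_wpDl.
apply: (@open_signature_orthant (x + (e / (`|w| + 1)) *: w)) => // i.
have t0 : 0 < e / (`|w| + 1) by rewrite divr_gt0.
have near_x : `|x + (e / (`|w| + 1)) *: w - x| <= e.
  rewrite addrC addKr normrZ gtr0_norm// mulrAC ler_pdivrMr//.
  by rewrite ler_pM2l// lerDl.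
have [zi|zi] := eqVneq (z x i 0) 0.
  rewrite switchingD zi wP// add0r mulrCA mulr_gt0//.
  by have /orP[/eqP ->|/eqP ->] := sigma1 i; rewrite ?mulr1 ?mulN1r ?opprK.
have sigma0 : sigma i 0 != 0.
  by have /orP[/eqP ->|/eqP ->] := sigma1 i; rewrite ?oppr_eq0 oner_eq0.
have : 0 < sigma i 0 * z x i 0 by rewrite lt_neqAle eq_sym mulf_neq0 //= nonneg.
by rewrite -sgr_gt0 sgrM -(eP _ near_x)// -sgrM sgr_gt0.
Qed.

(** An infeasible system of linear inequalities stays infeasible under a small
    perturbation.  Make it homogeneous by a variable tau >= 0: infeasibility
    then means that the system implies - tau >= 0, and [farkas_bound] at
    tau = 1 gives a positive lower bound for rho. *)
Lemma almost_feasible sigma :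
    (forall rho, 0 < rho -> exists x, forall i, - rho <= sigma i 0 * z x i 0) ->
  exists x, forall i, 0 <= sigma i 0 * z x i 0.
Proof.
move=> almost; apply: contrapT => none.
pose a i : 'rV[R]_(1 + n) := sigma i 0 *: row_mx (c i 0)%:M (row i Z).
pose tau : 'rV[R]_(1 + n) := row_mx 1%:M 0.
have aE i (t : R) x : (a i *m col_mx t%:M x) 0 0 =
    sigma i 0 * (c i 0 * t + (Z *m x) i 0).
  rewrite -scalemxAl mxE mul_row_col -scalar_mxM -row_mul; congr (_ * _).
  by rewrite !mxE eqxx mulr1n.
have tauE (t : R) x : (tau *m col_mx t%:M x) 0 0 = t.
  by rewrite mul_row_col mul1mx mul0mx addr0 mxE eqxx mulr1n.
have split_col (y : 'cV[R]_(1 + n)) :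
    y = col_mx ((usubmx y) 0 0)%:M (dsubmx y).
  by rewrite -[LHS]vsubmxK -mx11_scalar.
have [|C C0 CP] := @farkas_bound _ _ (tau :: [seq a i | i <- enum 'I_s]) (- tau).
  move=> y ypos; rewrite mulNmx mxE oppr_ge0 leNgt; apply/negP => ty.
  apply: none; move: ypos ty; rewrite (split_col y).
  set t := _ 0 0; set x := dsubmx y; rewrite tauE => ypos t0.
  exists (t^-1 *: x) => i; rewrite -(pmulr_rge0 _ t0).
  have := ypos (a i); rewrite inE map_f ?mem_enum ?orbT// => /(_ isT).
  rewrite aE -[t^-1 *: x]add0r switchingD /switching mulmx0 addr0.
  rewrite (_ : t * _ = sigma i 0 * (c i 0 * t + (Z *m x) i 0))//.
  by field; exact: lt0r_neq0.
have rho0 : 0 < (C + 1)^-1 by rewrite invr_gt0 ltr_wpDl.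
have [x xP] := almost _ rho0.
have := CP (col_mx 1%:M x) _ (ltW rho0).
rewrite mulNmx mxE tauE lerN2 => H; have {}H : 1 <= C * (C + 1)^-1.
  apply: H => v; rewrite inE => /predU1P[->|/mapP[i _ ->]].
    by rewrite tauE (le_trans _ ler01)// oppr_le0 ltW.
  by rewrite aE mulr1; have := xP i; rewrite /switching mxE.
move: H; rewrite ler_pdivlMr; last by rewrite ltr_wpDl.
by rewrite mul1r gerDl ler10.
Qed.

(** A property of a full signature and of a small positive number holds with one
    number for all full signatures, of which there are finitely many. *)
Lemma uniform_over_signatures (P : 'cV[R]_s -> R -> Prop) :
    (forall sigma, full_signature sigma ->
       exists2 e, 0 < e & forall e', 0 < e' <= e -> P sigma e') ->
  exists2 e, 0 < e & forall sigma, full_signature sigma -> P sigma e.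
Proof.
move=> HP; pose sgv (f : {ffun 'I_s -> bool}) : 'cV[R]_s := \col_i (-1) ^+ f i.
have [f|e e0 eP] := @uniform_radius R {ffun 'I_s -> bool} (fun f => P (sgv f)).
  by apply: HP => i; rewrite mxE; case: (f i); rewrite eqxx ?orbT.
exists e => // sigma sigma1.
have -> : sigma = sgv [ffun i => sigma i 0 == -1].
  apply/colP => i; rewrite mxE ffunE; case/orP: (sigma1 i) => /eqP ->.
    by rewrite -subr_eq0 opprK paddr_eq0 // oner_eq0.
  by rewrite eqxx.
exact: eP.
Qed.

(** If sigma is not open, then sigma_i z_i >= 0 has no solution by
    [open_signature_closure], so by [almost_feasible] it has none even up to
    some error rho > 0. *)
Lemma uniform_open_margin : LIKQ c Z ->
  exists2 rho, 0 < rho & forall sigma, full_signature sigma -> forall x,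
    (forall i, - rho <= sigma i 0 * z x i 0) -> open_signature c Z sigma.
Proof.
move=> likq; apply: uniform_over_signatures => sigma sigma1.
have [Oe|nOe] := pselect (open_signature c Z sigma); first by exists 1.
have /existsNP[rho /not_implyP[rho0 /forallNP none]] :
    ~ forall rho, 0 < rho -> exists x, forall i, - rho <= sigma i 0 * z x i 0.
  move=> /almost_feasible[x xP]; apply: nOe.
  exact: open_signature_closure likq sigma1 xP.
exists rho => // e' /andP[e'0 e'rho] x xP; case: (none x) => i.
by rewrite (le_trans _ (xP i))// lerN2.
Qed.

Lemma oriented_margin : coherently_oriented c Z J Y ->
  exists2 eps : R, `|eps| <= 1 & exists2 del, 0 < del & forall sigma,
    full_signature sigma -> open_signature c Z sigma ->
    del <= eps * \det (jac sigma).
Proof.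
move=> [nz same].
have [[tau tauO]|none] := pselect (exists tau, open_signature c Z tau); last first.
  (* Without open signatures any constants will do. *)
  exists 0; rewrite ?normr0//; exists 1 => // sigma _ sO.
  by case: none; exists sigma.
exists (Num.sg (\det (jac tau))); first by rewrite normr_sg; case: eqP.
apply: uniform_over_signatures => sigma _.
have [sO|nO] := pselect (open_signature c Z sigma); last by exists 1.
exists (Num.sg (\det (jac tau)) * \det (jac sigma)).
  by rewrite (same _ _ tauO sO) -normrEsg normr_gt0 nz.
by move=> e' /andP[].
Qed.

(** * Coherently oriented maps are bijective *)

(** A function that is affine in each coordinate separately attains its minimum
    over a box at a vertex: each coordinate in turn can be pushed to an end of
    its interval without increasing the value. *)
Lemma box_min (g : 'cV[R]_s -> R) l h D :
    (forall D k, exists q, forall e,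
       g (set_coord D k e) = g D + (e - D k 0) * q) ->
    in_box l h D ->
  exists2 sigma : 'cV[R]_s, (forall i, (sigma i 0 == h i 0) || (sigma i 0 == l i 0)) &
    g sigma <= g D.
Proof.
move=> g_affine Dbox.
suff: forall m, (m <= s)%N -> exists sigma, [/\ in_box l h sigma,
    (forall i : 'I_s, (i < m)%N -> (sigma i 0 == h i 0) || (sigma i 0 == l i 0)) &
    g sigma <= g D].
  by move=> /(_ s (leqnn s))[sigma [_ sigmaP gsigma]]; exists sigma => // i; apply: sigmaP.
elim=> [_|m IH ms]; first by exists D.
have [tau [taubox taum gtau]] := IH (ltnW ms).
have [q qP] := g_affine tau (Ordinal ms).
have /andP[tl th] := taubox (Ordinal ms); have lh := le_trans tl th.
pose e := if 0 <= q then l (Ordinal ms) 0 else h (Ordinal ms) 0.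
exists (set_coord tau (Ordinal ms) e); split.
- move=> i; rewrite set_coordE; case: eqP => [->|_]; last exact: taubox.
  by rewrite /e; case: (0 <= q); rewrite lexx lh.
- move=> i im; rewrite set_coordE; have [->|im'] := eqVneq i (Ordinal ms).
    by rewrite /e; case: (0 <= q); rewrite eqxx ?orbT.
  by apply: taum; rewrite ltn_neqAle -ltnS im andbT.
- rewrite qP (le_trans _ gtau)// gerDl /e; case: (leP 0 q) => q0.
    by rewrite mulr_le0_ge0// subr_le0.
  by rewrite mulr_ge0_le0 ?subr_ge0// ltW.
Qed.

Lemma cell_jacobian_bounded : exists2 B, 0 <= B &
  forall D, (forall k, `|D k 0| <= 1) -> forall i j, `|jac D i j| <= B.
Proof.
exists (`|J| + s%:R * (`|Y| * `|Z|)); first by rewrite addr_ge0// !mulr_ge0.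
move=> D D1 i j; rewrite cell_jacobianE (le_trans (ler_normD _ _))// lerD//.
  exact: mx_entry_le_norm.
rewrite (le_trans (ler_norm_sum _ _ _))// mulr_natl -[X in _ *+ X]card_ord.
rewrite -sumr_const ler_sum// => k _; rewrite !normrM.
rewrite ler_pM ?mulr_ge0// ?mx_entry_le_norm//.
by rewrite (le_trans (ler_piMr _ (D1 k)))// mx_entry_le_norm.
Qed.

(** The slopes of |z_i| that occur near x: only a component with
    |z_i(x)| <= rho keeps its kink. *)
Definition low_slope rho x : 'cV[R]_s :=
  \col_i if rho < z x i 0 then 1 else -1.

Definition high_slope rho x : 'cV[R]_s :=
  \col_i if z x i 0 < - rho then -1 else 1.

Lemma low_slopeE rho x i :
  low_slope rho x i 0 = if rho < z x i 0 then 1 else -1.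
Proof. by rewrite mxE. Qed.

Lemma high_slopeE rho x i :
  high_slope rho x i 0 = if z x i 0 < - rho then -1 else 1.
Proof. by rewrite mxE. Qed.

Lemma low_le_high rho x i : 0 < rho ->
  low_slope rho x i 0 <= high_slope rho x i 0.
Proof.
move=> rho0; rewrite low_slopeE high_slopeE.
by case: (ltP rho (z x i 0)) => h1; case: (ltP (z x i 0) (- rho)) => h2; lra.
Qed.

Lemma slope_box_le1 rho x D :
  in_box (low_slope rho x) (high_slope rho x) D -> forall k, `|D k 0| <= 1.
Proof.
move=> DB k; have := DB k; rewrite low_slopeE high_slopeE ler_norml.
by case: ifP => _; case: ifP => _ /andP[? ?]; apply/andP; split; lra.
Qed.

Lemma pl_map_near rho x u : n%:R * `|Z| * `|u - x| <= rho ->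
  F u = pl (low_slope rho x) (high_slope rho x) u.
Proof.
move=> ux; rewrite /switched_map /pl_map; congr (_ + _ *m _); apply/colP => i.
rewrite pl_cvE [LHS]mxE low_slopeE high_slopeE.
have := le_trans (switching_lipschitz c Z u x i) ux.
rewrite ler_distl => /andP[h1 h2].
have [zu|zu] := leP 0 (z u i 0).
  by rewrite (ger0_norm zu); case: ltP => h3; lra.
by rewrite (ltr0_norm zu); case: ltP => h3; lra.
Qed.

(** The vertices of the box are sign vectors that z nearly has at x, hence open
    signatures, and the determinant is at least its value at some vertex. *)
Lemma slope_box_det eps del rho x D : 0 < rho ->
    (forall sigma, full_signature sigma -> open_signature c Z sigma ->
       del <= eps * \det (jac sigma)) ->
    (forall sigma, full_signature sigma -> forall x,
       (forall i, - rho <= sigma i 0 * z x i 0) -> open_signature c Z sigma) ->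
    in_box (low_slope rho x) (high_slope rho x) D ->
  del <= eps * \det (jac D).
Proof.
move=> rho0 delP rhoP DB.
have [D' k|sigma sP] := @box_min (fun D => eps * \det (jac D)) _ _ _ _ DB.
  exists (eps * \det (block_mx 0 (row k Z) (- col k Y) (jac D'))) => e.
  by rewrite cell_jacobian_set det_rank1_update; ring.
have sigma1 : full_signature sigma.
  move=> i; have := sP i; rewrite low_slopeE high_slopeE.
  by case: ifP => _; case: ifP => _ /orP[] ->; rewrite ?orbT.
apply: le_trans; apply: delP => //.
apply: (rhoP _ sigma1 x) => i; have := sP i; rewrite low_slopeE high_slopeE.
by case: ltP => h1; case: ltP => h2 /orP[] /eqP ->; rewrite ?mul1r ?mulN1r; lra.
Qed.

(** The constants of [uniform_local_homeo_bijective]: the radius r keeps every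
    z_i within rho of its value at the centre, C inverts the secant matrices by
    [norm_det_le], and K bounds them. *)
Lemma oriented_bijective : LIKQ c Z -> coherently_oriented c Z J Y ->
  bijective F.
Proof.
move=> likq /oriented_margin[eps eps1 [del del0 delP]].
have [rho rho0 rhoP] := uniform_open_margin likq.
have [B B0 jacB] := cell_jacobian_bounded.
pose lo := low_slope rho; pose hi := high_slope rho.
have lohi x i : lo x i 0 <= hi x i 0 by exact: low_le_high.
have box_det x D : in_box (lo x) (hi x) D -> del <= eps * \det (jac D).
  exact: slope_box_det.
pose A := n%:R * (n.-1`!%:R * B ^+ n.-1).
have A0 : 0 <= A by rewrite !mulr_ge0// exprn_ge0.
pose C := A / del + 1.
have C0 : 0 < C by rewrite ltr_wpDl// divr_ge0// ltW.
have K0 : 0 < n%:R * B + 1 by rewrite ltr_wpDl// mulr_ge0.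
have NZ0 : 0 < n%:R * `|Z| + 1 by rewrite ltr_wpDl// mulr_ge0.
pose r := rho / (n%:R * `|Z| + 1).
have r0 : 0 < r by rewrite divr_gt0.
have expand x u v : `|u - v| <= C * `|pl (lo x) (hi x) u - pl (lo x) (hi x) v|.
  have [D DB ->] := pl_map_secant c b Z J Y u v (lohi x).
  have det_le := norm_det_le (u - v) B0 (jacB D (slope_box_le1 DB)).
  have le_det : del <= `|\det (jac D)|.
    rewrite (le_trans (box_det _ _ DB))// (le_trans (ler_norm _))// normrM.
    by rewrite ler_piMl.
  rewrite /C mulrDl mul1r (@le_trans _ _ (A / del * `|jac D *m (u - v)|))//.
    rewrite mulrAC ler_pdivlMr// mulrC (le_trans _ det_le)//.
    by rewrite ler_wpM2r.
  by rewrite lerDl.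
have near_pl x u : `|u - x| <= r -> F u = pl (lo x) (hi x) u.
  move=> ux; apply: pl_map_near.
  rewrite (@le_trans _ _ ((n%:R * `|Z| + 1) * r))//; last first.
    by rewrite /r mulrCA divff ?mulr1// gt_eqF.
  by rewrite ler_pM// ?mulr_ge0// lerDl.
apply: (@uniform_local_homeo_bijective R _ F r C (n%:R * B + 1)) => //.
- move=> u v.
  have const_cvE (a : R) (i : 'I_s) : (const_mx a : 'cV[R]_s) i 0 = a.
    by rewrite mxE.
  have [|D DB] := @pl_map_secant _ _ _ c b Z J Y (const_mx (-1)) (const_mx 1) u v.
    by move=> i; rewrite !const_cvE; lra.
  rewrite -!switched_mapE => ->; rewrite (@le_trans _ _ (n%:R * B * `|u - v|))//.
    apply: mulmx_norm_le => [|i j]; first exact: B0.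
    by apply: jacB => k; have := DB k; rewrite !const_cvE ler_norml.
  by rewrite ler_wpM2r// lerDl.
- by move=> x u v ux vx; rewrite (near_pl x u)// (near_pl x v)//; exact: expand.
- move=> x w wx; have Fx := near_pl x x.
  have [u uw] := @pl_map_surjective _ _ _ c b Z J Y eps _ _ w (lohi x)
    (fun D DB => lt_le_trans del0 (box_det x D DB)).
  have ux : `|u - x| <= C * `|w - F x|.
    by rewrite Fx ?subrr ?normr0 ?(ltW r0)// -uw; exact: expand.
  by exists u => //; rewrite (near_pl x) ?uw// (le_trans ux).
Qed.

End CoherentOrientation.

Theorem proposition4p1 (R : realType) (n s : nat)
    (c : 'cV[R]_s) (b : 'cV[R]_n) (Z : 'M[R]_(s, n)) (L : 'M[R]_s)
    (J : 'M[R]_n) (Y : 'M[R]_(n, s)) (F : 'cV[R]_n -> 'cV[R]_n)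
    (F_abs_normal : abs_normal_form c b Z L J Y F)
    (F_simply_switched : simply_switched L)
    (kinks_LIKQ : LIKQ c Z) :
  bijective F <-> coherently_oriented c Z J Y.
Proof.
have -> : F = switched_map c b Z J Y.
  apply/funext => x; have [_ /(_ x)[y [yE ->]]] := F_abs_normal.
  by rewrite yE F_simply_switched mul0mx addr0 /switched_map /switching.
split=> [/bij_inj|]; first exact: injective_oriented.
exact: oriented_bijective.
Qed.
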